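(* Let $n\ge 1$ and let $b=(b_1,\dots,b_n)$ be a sequence of positive integers. Then the Ehrhart ring $E(b)$ of the lecture hall polytope $P(b)$ is Koszul.
   Context: The lecture hall polytope is $P(b):=\{(x_1,\dots,x_n)\in\mathbb{R}^n : 0\le\frac{x_1}{b_1}\le\cdots\le\frac{x_n}{b_n}\le 1\}$. For $p=(p_1,\dots,p_n)\in kP(b)\cap\mathbb{Z}^n$, $k\in\mathbb{Z}_{\ge 0}$, put $t^{(p,k)}:=t_1^{p_1}\cdots t_n^{p_n}t_{n+1}^k$. The Ehrhart ring of $P(b)$ is the graded algebra $E(b):=\bigoplus_{k\ge 0}E(b)_k$, $E(b)_k:=\langle t^{(p,k)}\mid p\in kP(b)\cap\mathbb{Z}^n\rangle_{\mathbb{C}}$, with multiplication $t^{(p,k)}\cdot t^{(q,h)}=t^{(p+q,k+h)}$. A standard graded $\mathbb{C}$-algebra $A$ is Koszul if its residue field $\mathbb{C}=A/A_{>0}$ has a linear graded free resolution over $A$. *)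

(* Defs.v *)
From HB Require Import structures.
From mathcomp Require Import all_boot all_order all_algebra.
From mathcomp Require Import ring_quotient.
From mathcomp Require Import finmap.
From mathcomp Require Import boolp classical_sets reals.
From mathcomp Require Import monalg.

Set Implicit Arguments.
Unset Strict Implicit.
Unset Printing Implicit Defensive.

Import Order.TTheory GRing.Theory Num.Theory.

Local Open Scope ring_scope.

Definition lspan (K : pzRingType) (V : lmodType K) (S : set V) : set V :=
  [set x | exists s : seq (K * V),
     (forall cv, cv \in s -> S cv.2) /\ x = \sum_(cv <- s) cv.1 *: cv.2]%classic.

Record gradedAlg (K : fieldType) := GradedAlg {
  galg :> comAlgType K;
  homog : nat -> {pred galg};
  homog_submod : forall k, GRing.submod_closed (homog k);
  homog1 : 1 \in homog 0%N;
  homogM : forall k h x y,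
    x \in homog k -> y \in homog h -> x * y \in homog (k + h)%N;
  homog_span : forall x, exists N (c : nat -> galg),
    (forall k, c k \in homog k) /\ x = \sum_(k < N) c k;
  homog_direct : forall N (c : nat -> galg),
    (forall k, c k \in homog k) -> \sum_(k < N) c k = 0 ->
    forall k, (k < N)%N -> c k = 0
}.

Section IrrelevantIdeal.
Variables (K : fieldType) (A : gradedAlg K).

Definition irrelevant : {pred A} := [pred x : A |
  `[< exists N (c : nat -> A),
      (forall k, c k \in homog k) /\ x = \sum_(1 <= k < N) c k >]].

Lemma homog_linear k (a : K) (x y : A) :
  x \in @homog K A k -> y \in @homog K A k -> a *: x + y \in @homog K A k.
Proof. by move=> hx hy; have [_ h] := @homog_submod K A k; apply: h. Qed.

Lemma homog0 k : 0 \in @homog K A k.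
Proof. by have [] := @homog_submod K A k. Qed.

Lemma homogD k (x y : A) :
  x \in @homog K A k -> y \in @homog K A k -> x + y \in @homog K A k.
Proof. by move=> hx hy; rewrite -[x]scale1r homog_linear. Qed.

Lemma irrelevantP (x : A) : reflect
  (exists N (c : nat -> A), (forall k, c k \in homog k) /\
                            x = \sum_(1 <= k < N) c k)
  (x \in irrelevant).
Proof. by rewrite inE; apply: asboolP. Qed.

Lemma irrelevant_pad (x : A) : x \in irrelevant ->
  exists N (c : nat -> A), [/\ forall k, c k \in homog k, c 0 = 0 &
    forall M, (N <= M)%N -> x = \sum_(k < M) c k].
Proof.
case/irrelevantP=> N [c [hc ->]].
pose d k := if (0 < k < N)%N then c k else 0.
exists N, d; split=> // [k|M leNM].
  by rewrite /d; case: ifP => _; rewrite ?homog0.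
rewrite -(big_mkord xpredT d) -big_mkcond /=.
rewrite (big_nat_widen _ _ _ _ _ leNM) (big_nat_widenl 1 0) //.
by apply: eq_bigl => k; rewrite andbC.
Qed.

Lemma irrelevant_sum (c : nat -> A) M :
  (forall k, c k \in homog k) -> c 0 = 0 -> \sum_(k < M) c k \in irrelevant.
Proof.
move=> hc c0; apply/irrelevantP; exists M, c; split=> //.
case: M => [|M]; first by rewrite big_ord0 big_geq.
by rewrite -(big_mkord xpredT c) big_nat_recl // c0 add0r big_add1.
Qed.

Lemma irrelevantD (x y : A) :
  x \in irrelevant -> y \in irrelevant -> x + y \in irrelevant.
Proof.
move=> /irrelevant_pad[N [c [hc c0 xE]]] /irrelevant_pad[M [d [hd d0 yE]]].
rewrite (xE _ (leq_maxl N M)) (yE _ (leq_maxr N M)) -big_split /=.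
apply: (irrelevant_sum (c := fun k => c k + d k)); last by rewrite c0 d0 addr0.
by move=> k; rewrite homogD.
Qed.

Lemma irrelevant0 : 0 \in irrelevant.
Proof.
by apply/irrelevantP; exists 0, (fun=> 0); split=> [k|]; rewrite ?homog0 ?big_geq.
Qed.

Lemma irrelevant_big (I : Type) (r : seq I) (F : I -> A) :
  (forall i, F i \in irrelevant) -> \sum_(i <- r) F i \in irrelevant.
Proof.
by move=> h; elim/big_rec: _ => [|i y _]; [exact: irrelevant0|exact: irrelevantD].
Qed.

Lemma irrelevant_homog k (x : A) :
  x \in @homog K A k -> (0 < k)%N -> x \in irrelevant.
Proof.
move=> hx k0.
have -> : x = \sum_(j < k.+1) (if j == k :> nat then x else 0).
  by rewrite -big_mkcond /= (big_pred1 ord_max) // => i; rewrite -val_eqE.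
apply: (irrelevant_sum (c := fun j => if j == k then x else 0)).
  by move=> j; case: eqP => [->|_]; rewrite ?homog0.
by case: k k0 {hx}.
Qed.

Lemma irrelevant_closed : idealr_closed irrelevant.
Proof.
split; first exact: irrelevant0.
  apply/negP=> /irrelevant_pad[N [c [hc c0 oneE]]].
  pose d k : A := if k == 0 then -1 else c k.
  have hd k : d k \in homog k.
    rewrite /d; case: eqP => [->|//].
    by rewrite -scaleN1r -[_ *: _]addr0 homog_linear ?homog0 ?homog1.
  have d0 : \sum_(k < N.+1) d k = 0.
    rewrite big_ord_recl /d /= [X in _ + X](_ : _ = 1) ?addNr //.
    by rewrite [RHS](oneE N.+1) // big_ord_recl c0 add0r.
  have /eqP := homog_direct hd d0 (ltn0Sn N).
  by rewrite /d /= oppr_eq0 oner_eq0.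
move=> a x y hx; apply: irrelevantD.
have [N [d [hd ->]]] := homog_span a.
case/irrelevantP: hx => M [c [hc ->]].
rewrite mulr_suml; apply: irrelevant_big => i.
rewrite mulr_sumr big_nat_cond big_mkcond; apply: irrelevant_big => j.
case: ifP => [/andP[/andP[j0 _] _]|_]; last exact: irrelevant0.
by apply: irrelevant_homog (homogM (hd i) (hc j)) _; rewrite addn_gt0 j0 orbT.
Qed.

HB.instance Definition _ := isIdealr.Build A irrelevant irrelevant_closed.

Definition residue := {ideal_quot irrelevant}.

HB.instance Definition _ := GRing.ComNzRing.on residue.

Definition residue_pi (a : A) : residue := \pi_residue%qT a.

Definition residue_scale (a : A) (x : residue) : residue := residue_pi a * x.

Fact residue_scaleA a b x :
  residue_scale a (residue_scale b x) = residue_scale (a * b) x.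
Proof. by rewrite /residue_scale /residue_pi mulrA rmorphM. Qed.

Fact residue_scale1 : left_id 1 residue_scale.
Proof. by move=> x; rewrite /residue_scale /residue_pi rmorph1 mul1r. Qed.

Fact residue_scaleDr : right_distributive residue_scale +%R.
Proof. by move=> a x y; rewrite /residue_scale mulrDr. Qed.

Fact residue_scaleDl x : {morph residue_scale^~ x : a b / a + b}.
Proof. by move=> a b; rewrite /residue_scale /residue_pi rmorphD mulrDl. Qed.

HB.instance Definition _ := GRing.Zmodule_isLmodule.Build A residue
  residue_scaleA residue_scale1 residue_scaleDr residue_scaleDl.

Definition residue_homog (k : nat) : {pred residue} :=
  [pred x | `[< exists2 a : A, a \in homog k & residue_pi a = x >]].

End IrrelevantIdeal.

Section Koszul.
Variables (K : fieldType) (A : gradedAlg K).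

Definition standard_graded : Prop :=
  [/\ forall x : A, x \in homog 0 -> exists c : K, x = c%:A,
      exists s : seq A, forall x : A, x \in homog 1 ->
        lspan [set` s]%classic x
    & forall S : {pred A}, GRing.subalg_closed S ->
        {subset @homog K A 1 <= S} -> forall x : A, x \in S].

(* The degree k part of the direct sum of the A(- d j), j < r. *)
Definition free_homog r (d : 'I_r -> nat) (k : nat) : {pred 'rV[A]_r} :=
  [pred v : 'rV[A]_r | [forall j : 'I_r,
     if (d j <= k)%N then v ord0 j \in homog (k - d j) else v ord0 j == 0]].

(* Ranks are finite and generators sit in degrees >= 0: for the residue field
   of a standard graded algebra this excludes no linear resolution, since a
   linear resolution is minimal and the Betti numbers are finite. *)
Record gradedFreeResolution (M : lmodType A) (Mhomog : nat -> {pred M}) :=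
  GradedFreeResolution {
  res_rank : nat -> nat;
  res_shift : forall i, 'I_(res_rank i) -> nat;
  res_diff : forall i,
    {linear 'rV[A]_(res_rank i.+1) -> 'rV[A]_(res_rank i)};
  res_aug : {linear 'rV[A]_(res_rank 0) -> M};
  res_diff_homog : forall i k v, v \in free_homog (@res_shift i.+1) k ->
    res_diff i v \in free_homog (@res_shift i) k;
  res_aug_homog : forall k v, v \in free_homog (@res_shift 0) k ->
    res_aug v \in Mhomog k;
  res_aug_surj : forall m, exists v, res_aug v = m;
  res_exact0 : forall v, res_aug v = 0 <-> exists w, res_diff 0 w = v;
  res_exactS : forall i v,
    res_diff i v = 0 <-> exists w, res_diff i.+1 w = v
}.

Definition linear_resolution (M : lmodType A) (Mhomog : nat -> {pred M})
    (F : gradedFreeResolution Mhomog) : Prop :=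
  forall i (j : 'I_(res_rank F i)), res_shift j = i.

Definition koszul : Prop :=
  standard_graded /\
  exists F : gradedFreeResolution (@residue_homog K A), linear_resolution F.

End Koszul.

Section LectureHall.
Variables (R : realType) (n : nat) (b : 'I_n -> nat).

Definition lecture_hall : set 'rV[R]_n :=
  [set x | path <=%R 0
     (rcons [seq x ord0 i / (b i)%:R | i <- enum 'I_n] 1)]%classic.

Definition dilated_lecture_hall (k : nat) : set 'rV[R]_n :=
  [set k%:R *: x | x in lecture_hall]%classic.

Definition is_exponent : pred ('rV[int]_n * nat) :=
  fun u => map_mx (fun z : int => z%:~R) u.1 \in dilated_lecture_hall u.2.

Record exponent : Type := Exponent {
  exponent_val :> 'rV[int]_n * nat;
  _ : is_exponent exponent_val
}.

HB.instance Definition _ := [isSub for exponent_val].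
HB.instance Definition _ := [Choice of exponent by <:].

Lemma path_combine (I : Type) (s : seq I) (f g : I -> R) (a a' e e' c d : R) :
  0 <= c -> 0 <= d ->
  path <=%R a (rcons [seq f i | i <- s] e) ->
  path <=%R a' (rcons [seq g i | i <- s] e') ->
  path <=%R (c * a + d * a')
    (rcons [seq c * f i + d * g i | i <- s] (c * e + d * e')).
Proof.
move=> c0 d0; elim: s a a' => [|i s IHs] a a' /=.
  by rewrite !andbT => h h'; rewrite lerD // ler_wpM2l.
by move=> /andP[h hs] /andP[h' hs']; rewrite IHs // andbT lerD // ler_wpM2l.
Qed.

Lemma lecture_hall0 : lecture_hall 0.
Proof.
rewrite /lecture_hall /=; elim: (enum 'I_n) => [|i s IHs] /=.
  by rewrite ler01.
by rewrite mxE mul0r lexx.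
Qed.

Lemma lecture_hall_convex (x y : 'rV[R]_n) (c d : R) :
  lecture_hall x -> lecture_hall y -> 0 <= c -> 0 <= d -> c + d = 1 ->
  lecture_hall (c *: x + d *: y).
Proof.
rewrite /lecture_hall /= => hx hy c0 d0 cd1.
have := path_combine c0 d0 hx hy; rewrite !mulr0 !mulr1 cd1 addr0.
by under eq_map do rewrite !mulrA -mulrDl;
   under [X in _ -> is_true (path _ _ (rcons X _))]eq_map do rewrite !mxE.
Qed.

Fact exponent_one_subproof : is_exponent (0, 0).
Proof.
apply/mem_set; exists 0; first exact: lecture_hall0.
by rewrite scaler0; apply/rowP => i; rewrite !mxE.
Qed.

Fact exponent_mul_subproof (u v : exponent) :
  is_exponent (u.1 + v.1, (u.2 + v.2)%N).
Proof.
case: u v => [[p k] /= /set_mem[x hx /= xE]] [[q h] /= /set_mem[y hy /= yE]].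
apply/mem_set => /=.
have map_pq : map_mx (fun z : int => z%:~R) (p + q) =
    k%:R *: x + h%:R *: y :> 'rV[R]_n.
  by rewrite xE yE; apply/rowP => i; rewrite !mxE rmorphD.
have [kh0|kh0] := eqVneq (k + h)%N 0.
  move/eqP: kh0 map_pq; rewrite addn_eq0 => /andP[/eqP-> /eqP->] ->.
  exists 0; first exact: lecture_hall0.
  by rewrite !scale0r addr0.
have khR : (k + h)%:R != 0 :> R by rewrite pnatr_eq0.
exists ((k%:R / (k + h)%:R) *: x + (h%:R / (k + h)%:R) *: y).
  apply: lecture_hall_convex => //; rewrite ?divr_ge0 ?ler0n //.
  by rewrite -mulrDl -natrD divff.
by rewrite scalerDr !scalerA !(mulrC (k + h)%:R) !divfK // map_pq.
Qed.

Definition exponent_one : exponent := Exponent exponent_one_subproof.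
Definition exponent_mul (u v : exponent) : exponent :=
  Exponent (exponent_mul_subproof u v).

Fact exponent_mulA : associative exponent_mul.
Proof. by move=> u v w; apply: val_inj; rewrite /= addrA addnA. Qed.

Fact exponent_mulC : commutative exponent_mul.
Proof. by move=> u v; apply: val_inj; rewrite /= addrC addnC. Qed.

Fact exponent_mul1m : left_id exponent_one exponent_mul.
Proof. by move=> [[p k] h]; apply: val_inj; rewrite /= add0r. Qed.

Fact exponent_mulm1 : right_id exponent_one exponent_mul.
Proof. by move=> u; rewrite exponent_mulC exponent_mul1m. Qed.

Lemma exponent_deg0 (u : exponent) : u.2 = 0%N -> u = exponent_one.
Proof.
case: u => [[p k] /[dup] /set_mem /= [x _ xE] h] /= k0.
apply: val_inj => /=; rewrite {}k0 in xE *; congr pair.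
apply/rowP => i; move/rowP/(_ i): xE; rewrite !mxE mul0r => /esym/eqP.
by rewrite intr_eq0 => /eqP.
Qed.

Fact exponent_unit u v :
  exponent_mul u v = exponent_one -> u = exponent_one /\ v = exponent_one.
Proof.
move=> /(congr1 (fun w : exponent => w.2)) /= /eqP.
by rewrite addn_eq0 => /andP[/eqP u0 /eqP v0]; split; apply: exponent_deg0.
Qed.

HB.instance Definition _ := Choice_isMonomialDef.Build exponent
  exponent_mulA exponent_mul1m exponent_mulm1 exponent_unit.
HB.instance Definition _ := MonomialDef_isConomialDef.Build exponent
  exponent_mulC.

End LectureHall.

Lemma monalgU_scale (K : nzRingType) (M : choiceType) (a : K) (u : M) :
  << a *g u >> = a *: << u >> :> {malg K[M]}.
Proof. by apply/malgP => v; rewrite mcoeffZ !mcoeffU mulrnAr mulr1. Qed.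

Section EhrhartRing.
Variables (K : fieldType) (R : realType) (n : nat) (b : 'I_n -> nat).
Local Notation exponent := (exponent R b).

(* The basis vector << u >> of monalg is t^(p,k) for u = (p,k). *)
Local Notation ehrhart_alg := {malg K[exponent]}.

Definition ehrhart_homog (k : nat) : {pred ehrhart_alg} :=
  [pred x : ehrhart_alg | `[< lspan [set << u >> | u in [set u : exponent | u.2 = k]]%classic
                      x >]].

Lemma ehrhart_homogP k (x : ehrhart_alg) :
  x \in ehrhart_homog k <-> forall u, x@_u != 0 -> u.2 = k.
Proof.
split.
  rewrite inE => -[s [hs ->]] u; apply: contra_neqP => uk.
  rewrite raddf_sum big_seq big1 // => -[c v] /hs /= [w /= wk <-].
  by rewrite mcoeffZ mcoeffU; case: eqP uk => [<-|_]; rewrite ?wk ?mulr0.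
move=> h; rewrite inE.
exists [seq (x@_u, << u >>) | u <- msupp x]; split.
  move=> _ /mapP[u ux ->] /=; exists u => //=.
  by apply: h; rewrite mcoeff_neq0.
rewrite big_map {1}[x]monalgE; apply: eq_bigr => u _ /=.
exact: monalgU_scale.
Qed.

Fact ehrhart_homog_submod k : GRing.submod_closed (ehrhart_homog k).
Proof.
split; first by apply/ehrhart_homogP => u; rewrite mcoeff0 eqxx.
move=> a x y /ehrhart_homogP hx /ehrhart_homogP hy; apply/ehrhart_homogP => u.
have [x0|/hx->//] := eqVneq x@_u 0; have [y0|/hy->//] := eqVneq y@_u 0.
by rewrite mcoeffD mcoeffZ x0 y0 mulr0 addr0 eqxx.
Qed.

Fact ehrhart_homog1 : (1 : ehrhart_alg) \in ehrhart_homog 0.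
Proof.
apply/ehrhart_homogP => u; rewrite mcoeff1.
by case: (u =P mone) => [->|_]; rewrite ?eqxx.
Qed.

Fact ehrhart_homogM k h (x y : ehrhart_alg) :
  x \in ehrhart_homog k -> y \in ehrhart_homog h ->
  x * y \in ehrhart_homog (k + h).
Proof.
move=> /ehrhart_homogP hx /ehrhart_homogP hy; apply/ehrhart_homogP => u.
rewrite mcoeff_neq0 => /msuppM_le[v [w [vx wy ->]]] /=.
by congr addn; [apply: hx|apply: hy]; rewrite mcoeff_neq0.
Qed.

Fact ehrhart_homog_span (x : ehrhart_alg) :
  exists N (c : nat -> ehrhart_alg),
    (forall k, c k \in ehrhart_homog k) /\ x = \sum_(k < N) c k.
Proof.
exists (\max_(u <- msupp x) u.2).+1.
exists (fun k => \sum_(u <- msupp x | u.2 == k) << x@_u *g u >>); split.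
  move=> k; apply/ehrhart_homogP => u; apply: contra_neqP => uk.
  rewrite raddf_sum big1 // => v /eqP vk.
  by rewrite /= mcoeffU; case: eqP uk => // <-; rewrite vk.
rewrite (exchange_big_dep xpredT) //= {1}[x]monalgE.
rewrite big_seq [RHS]big_seq; apply: eq_bigr => u ux.
have uN : (u.2 < (\max_(v <- msupp x) v.2).+1)%N.
  by rewrite ltnS (big_rem u) //= leq_maxl.
by rewrite (big_pred1 (Ordinal uN)) // => j; rewrite -val_eqE eq_sym.
Qed.

Fact ehrhart_homog_direct N (c : nat -> ehrhart_alg) :
  (forall k, c k \in ehrhart_homog k) -> \sum_(k < N) c k = 0 ->
  forall k, (k < N)%N -> c k = 0.
Proof.
move=> hc c0 k kN; apply/malgP => u; rewrite mcoeff0.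
have [uk|uk] := eqVneq u.2 k; last first.
  by apply: contra_neq_eq uk => /(ehrhart_homogP _ _).1; apply; exact: hc.
move/(congr1 (mcoeff u)): c0; rewrite mcoeff0 raddf_sum.
rewrite (bigD1 (Ordinal kN)) //= big1 ?addr0 // => j jk.
apply/eqP; apply: contraNT jk => /((ehrhart_homogP _ _).1 (hc j)) uj.
by rewrite -val_eqE /= -uj uk.
Qed.

Definition ehrhart_ring : gradedAlg K :=
  @GradedAlg K ehrhart_alg ehrhart_homog ehrhart_homog_submod ehrhart_homog1 ehrhart_homogM
    ehrhart_homog_span ehrhart_homog_direct.

End EhrhartRing.

(* Main.v *)
(* The algebra has a Koszul filtration in the sense of Conca, Trung and Valla:
   a family of ideals, containing the irrelevant ideal, such that each member
   has a list of linear generators whose successive colon ideals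
   (x_1, ..., x_(j-1)) : x_j lie in the family again.  If the successive colon
   ideals of a list of vectors with linear entries lie in the family, then so do
   those of a suitable list of syzygies, obtained by lifting the generators of
   each colon ideal; iterating gives a linear resolution of the residue field.

   For a lattice point u = (p, k) with k > 0, the point last(u), with coordinates
   max(0, p_i - (k - 1) b_i), is a lattice point of P(b) and u - last(u) lies in
   (k - 1)P(b).  The filtration consists of the monomial ideals for which
   membership of u depends only on last(u) and is inherited by coordinatewise
   smaller points of P(b).  Listing the generators of such an ideal by increasing
   coordinate sum, the colon ideal at q is spanned by the (p, k) such that
   p_i < k b_i for some i with q_i > 0, and it belongs to the filtration. *)
Require Import Defs.
From HB Require Import structures.
From mathcomp Require Import all_boot all_order all_algebra.
From mathcomp Require Import finmap zify.
From mathcomp Require Import ring_quotient boolp classical_sets reals complex.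
From mathcomp Require Import monalg.

Set Implicit Arguments.
Unset Strict Implicit.
Unset Printing Implicit Defensive.

Import Order.TTheory GRing.Theory Num.Theory.

Local Open Scope ring_scope.

(** * Spans of lists of vectors and their successive colon ideals *)

Section LinearCombination.
Variables (A : comNzRingType).
Implicit Types V W : lmodType A.

Definition lincomb V (m : seq V) (v : 'rV[A]_(size m)) : V :=
  \sum_(j < size m) v 0 j *: m`_j.

Fact lincomb_is_linear V (m : seq V) : linear (lincomb (m := m)).
Proof.
move=> a v w; rewrite /lincomb scaler_sumr -big_split; apply: eq_bigr => j _.
by rewrite !mxE scalerDl scalerA.
Qed.

HB.instance Definition _ V (m : seq V) :=
  GRing.isLinear.Build A 'rV[A]_(size m) V *:%R (lincomb (m := m))
    (lincomb_is_linear (m := m)).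

Definition cons_row r (a : A) (v : 'rV[A]_r) : 'rV[A]_r.+1 :=
  \row_j (if unlift ord0 j is Some j' then v 0 j' else a).

Definition behead_row r (w : 'rV[A]_r.+1) : 'rV[A]_r :=
  \row_j w 0 (lift ord0 j).

Lemma cons_rowK r (w : 'rV[A]_r.+1) : cons_row (w 0 0) (behead_row w) = w.
Proof. by apply/rowP => j; rewrite !mxE; case: unliftP => [j' ->|->]; rewrite ?mxE. Qed.

Lemma cons_row0 r a (v : 'rV[A]_r) : cons_row a v 0 0 = a.
Proof. by rewrite mxE unlift_none. Qed.

Lemma behead_cons r a (v : 'rV[A]_r) : behead_row (cons_row a v) = v.
Proof. by apply/rowP => j; rewrite !mxE liftK. Qed.

Fact cons0_is_linear r : linear (@cons_row r 0).
Proof.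
move=> a v w; apply/rowP => j; rewrite !mxE.
by case: unliftP => [j' _|_]; rewrite ?mxE ?mulr0 ?addr0.
Qed.

HB.instance Definition _ r :=
  GRing.isLinear.Build A 'rV[A]_r 'rV[A]_r.+1 *:%R (@cons_row r 0)
    (@cons0_is_linear r).

(** Turns ideal generators into rows of length 1, so that the resolution starts from a list of rows,
    as at every later step. *)
Definition row1 (a : A^o) : 'rV[A]_1 := const_mx a.

Fact row1_is_linear : linear row1.
Proof. by move=> a v w; apply/rowP => j; rewrite !mxE. Qed.

HB.instance Definition _ :=
  GRing.isLinear.Build A A^o 'rV[A]_1 *:%R row1 row1_is_linear.

Lemma row1_inj : injective row1.
Proof. by move=> a c /rowP/(_ 0); rewrite !mxE. Qed.

Lemma lincomb_cons V (x : V) m (w : 'rV[A]_(size m).+1) :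
  lincomb (m := x :: m) w = w 0 0 *: x + lincomb (behead_row w).
Proof.
rewrite /lincomb big_ord_recl; congr (_ + _).
by apply: eq_bigr => j _; rewrite mxE.
Qed.

(** Recursive, so that inductions on the list remove the head generator together with its
    coefficient. *)
Fixpoint rspan V (m : seq V) (y : V) : Prop :=
  if m is x :: m' then exists a, rspan m' (y - a *: x) else y = 0.

Lemma rspanP V (m : seq V) y : rspan m y <-> exists v, lincomb (m := m) v = y.
Proof.
elim: m y => [|x m IHm] y.
  split=> [->|[v <-]]; first by exists 0; rewrite linear0.
  by rewrite /= /lincomb big_ord0.
split=> [[a /IHm[v vE]]|[w <-]].
  by exists (cons_row a v); rewrite lincomb_cons cons_row0 behead_cons vE subrKC.
exists (w 0 0); apply/IHm; exists (behead_row w).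
by rewrite lincomb_cons [w 0 0 *: x + _]addrC addrK.
Qed.

Lemma rspanD V (m : seq V) y z : rspan m y -> rspan m z -> rspan m (y + z).
Proof.
move=> /rspanP[v <-] /rspanP[w <-]; apply/rspanP.
by exists (v + w); rewrite linearD.
Qed.

Lemma rspanZ V (m : seq V) a y : rspan m y -> rspan m (a *: y).
Proof. by move=> /rspanP[v <-]; apply/rspanP; exists (a *: v); rewrite linearZ. Qed.

Lemma rspan_mem V (m : seq V) y : y \in m -> rspan m y.
Proof.
elim: m => // x m IHm; rewrite in_cons => /predU1P[->|/IHm h] /=.
  by exists 1; rewrite scale1r subrr; apply/rspanP; exists 0; rewrite linear0.
by exists 0; rewrite scale0r subr0.
Qed.

Lemma rspan_map V W (f : {linear V -> W}) (m : seq V) y :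
  injective f -> rspan (map f m) (f y) <-> rspan m y.
Proof.
move=> injf; elim: m y => [|x m IHm] y /=.
  by split=> [|->]; rewrite ?linear0 // => fy0; apply: injf; rewrite fy0 linear0.
by split=> -[a h]; exists a; move: h; rewrite -linearZ -linearB => /IHm.
Qed.

(* Generators are listed in reverse order: each one is compared with the
   submodule rspanned by those behind it. *)
Fixpoint colons_in V (F : set (set A)) (m : seq V) : Prop :=
  if m is x :: m' then
    F [set a | rspan m' (a *: x)]%classic /\ colons_in F m'
  else True.

(** An injective linear map reflects membership in spans, so it leaves every colon ideal
    unchanged. *)
Lemma colons_in_map V W (f : {linear V -> W}) F (m : seq V) :
  injective f -> colons_in F m -> colons_in F (map f m).
Proof.
move=> injf; elim: m => //= x m IHm [Fx /IHm Fm]; split=> //.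
congr F: Fx; apply/seteqP.
by split=> a /=; rewrite -linearZ => /(rspan_map _ _ injf).
Qed.

Lemma rspan_map_cons0 r (m : seq 'rV[A]_r) w :
  rspan (map (@cons_row r 0) m) w -> w 0 0 = 0.
Proof.
elim: m w => [|x m IHm] w /=; first by move=> ->; rewrite mxE.
by case=> a /IHm; rewrite !mxE unlift_none mulr0 subr0.
Qed.

End LinearCombination.

(** * Syzygies and the linear resolution of the residue field *)

Lemma residue_pi_eq0 (K : fieldType) (A : gradedAlg K) (a : A) :
  residue_pi a = 0 <-> a \in @irrelevant K A.
Proof.
have := Quotient.idealrBE (@irrelevant K A) a 0; rewrite subr0 => ->.
have <- : residue_pi (0 : A) = 0 by rewrite /residue_pi rmorph0.
by split=> [h|/eqP//]; apply/eqP.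
Qed.

Section Syzygies.
Variables (K : fieldType) (A : gradedAlg K) (F : set (set A)).

Definition linear_row r (v : 'rV[A]_r) := forall j, v 0 j \in @homog K A 1.

Hypothesis generated : forall I, F I -> exists g : seq A^o,
  [/\ {subset g <= @homog K A 1}, colons_in F g & I = rspan g].

(** The family [c] is extended by zero, so that the decompositions of several elements can share one
    bound [M]. *)
Lemma homog_padded_span (x : A) : exists c : nat -> A,
  (forall k, c k \in homog k) /\
  exists N, forall M, (N <= M)%N -> x = \sum_(k < M) c k.
Proof.
have [N [c [hc ->]]] := homog_span x.
exists (fun k => if (k < N)%N then c k else 0); split.
  by move=> k; case: ifP => _; rewrite ?homog0.
exists N => M leNM; rewrite (big_ord_widen _ c leNM) big_mkcond.
by apply: eq_bigr.
Qed.

Lemma homog_sum (I : Type) (r : seq I) (f : I -> A) k :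
  (forall i, f i \in @homog K A k) -> \sum_(i <- r) f i \in @homog K A k.
Proof.
by move=> h; elim/big_rec: _ => [|i x _]; [exact: homog0|exact: homogD].
Qed.

Lemma homogN k (x : A) : x \in @homog K A k -> - x \in @homog K A k.
Proof. by move=> hx; rewrite -scaleN1r -[_ *: _]addr0 homog_linear ?homog0. Qed.

Lemma linear_coefficients r (m : seq 'rV[A]_r) (y : 'rV[A]_r) :
  {in m, forall x, linear_row x} -> (forall j, y 0 j \in @homog K A 2) ->
  rspan m y -> exists2 v, linear_row v & lincomb (m := m) v = y.
Proof.
move=> hm hy /rspanP[v vE].
have /choice[c /all_and2[hc /choice[N hN]]] :=
  fun j : 'I_(size m) => homog_padded_span (v 0 j).
(* It suffices to replace the coefficients by their degree 1 components. *)
have hmj (j : 'I_(size m)) l : m`_j 0 l \in @homog K A 1 by apply/hm/mem_nth.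
exists (\row_j c j 1%N) => [j|]; first by rewrite mxE.
apply/rowP => l; rewrite -vE; apply/esym/eqP; rewrite -subr_eq0; apply/eqP.
pose M := (\max_j N j).+3.
have le_NM j : (N j <= M)%N.
  by rewrite /M -[X in (_ <= X)%N]addn3 (leq_trans (leq_bigmax j)) ?leq_addr.
(* [e k] is the degree [k] component of entry [l] of [lincomb v - y]: products with linear entries
   shift the index by one, and [y] is subtracted in degree 2. The components sum to 0, so [e 2]
   vanishes by directness. *)
pose e k := if k is k'.+1 then
  \sum_j c j k' * m`_j 0 l - (if k' == 1%N then y 0 l else 0) else 0.
have he k : e k \in homog k.
  case: k => [|k] /=; first exact: homog0.
  apply: homogD; first by apply: homog_sum => j; rewrite -[k.+1]addn1 homogM.
  by apply: homogN; case: eqP => [->|_]; rewrite ?homog0.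
have sum_e : \sum_(k < M.+1) e k = 0.
  rewrite big_ord_recl add0r /= sumrB -big_mkcond /=.
  rewrite exchange_big [X in _ - X](big_pred1 (Ordinal (isT : (1 < M)%N))) //=.
  rewrite -vE /lincomb summxE -sumrB big1 // => j _.
  by rewrite mxE -mulr_suml (hN j M) ?subrr.
have := homog_direct he sum_e (isT : (2 < M.+1)%N); rewrite /= => /eqP.
rewrite subr_eq0 => /eqP; rewrite -vE => <-.
rewrite /lincomb summxE -sumrB big1 // => j _.
by rewrite !mxE subrr.
Qed.

Definition syzygy_generators r (m : seq 'rV[A]_r) (Z : seq 'rV[A]_(size m)) :=
  [/\ {in Z, forall z, linear_row z}, colons_in F Z
    & forall v, lincomb (m := m) v = 0 <-> rspan Z v].

(** Through the first coordinate, the syzygies of [x :: m] form an extension of the colon ideal of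
    [x] by the syzygies of [m]. Lifts of generators of the former and zero-padded generators of the
    latter span them. *)
Lemma syzygy_generators_exist r (m : seq 'rV[A]_r) :
  {in m, forall x, linear_row x} -> colons_in F m ->
  exists Z : seq 'rV[A]_(size m), syzygy_generators Z.
Proof.
elim: m => [|x m IHm] hm /=.
  move=> _; exists [::]; split=> // v; split=> _; last by rewrite /lincomb big_ord0.
  by apply/rowP => -[].
case=> Fx /IHm[z zm|Z [Zlin FZ ZE]].
  by apply: hm; rewrite in_cons zm orbT.
have [g [glin Fg gE]] := generated Fx.
(* [choice] needs a vector for every [f]; 0 is a dummy value outside [g]. *)
have /choice[h hP] (f : A) : exists v : 'rV[A]_(size m),
    f \in g -> linear_row v /\ lincomb v = f *: x.
  case: (boolP (f \in g)) => [fg|_]; last by exists 0.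
  have [|||v] := @linear_coefficients _ m (f *: x).
  - by move=> z zm; apply: hm; rewrite in_cons zm orbT.
  - by move=> j; rewrite mxE (homogM (glin _ fg)) // hm ?mem_head.
  - by have : @rspan A A^o g f := @rspan_mem A A^o g f fg; rewrite -gE.
  by exists v.
have {}hP : forall f, f \in g -> linear_row (h f) /\ lincomb (h f) = f *: x.
  by move=> f; apply: hP.
pose lift f := cons_row f (- h f).
pose Z0 : seq 'rV[A]_(size m).+1 := map (@cons_row A (size m) 0) Z.
have cons0_inj : injective (@cons_row A (size m) 0).
  by move=> v w /(congr1 (@behead_row A _)); rewrite !behead_cons.
have lin_lift f : f \in g -> lincomb (m := x :: m) (lift f) = 0.
  move=> /hP[_ hf]; rewrite lincomb_cons cons_row0 behead_cons.
  by rewrite linearN /= hf subrr.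
(* For [s = g] this gives exactness; for the tails of [g] it computes the successive colon
   ideals. *)
have rspan_lift (s : seq A^o) w : {subset s <= g} ->
    rspan (map lift s ++ Z0) w <->
    lincomb (m := x :: m) w = 0 /\ rspan s (w 0 0).
  elim: s w => [|f s IHs] w sg /=.
    rewrite lincomb_cons; split=> [hw|[hw w0]]; last first.
      rewrite -(cons_rowK w) w0; apply/(rspan_map _ _ cons0_inj)/ZE.
      by move: hw; rewrite w0 scale0r add0r.
    have w0 := rspan_map_cons0 hw.
    split=> //; rewrite w0 scale0r add0r; apply/ZE/(rspan_map _ _ cons0_inj).
    by move: hw; rewrite /= -w0 cons_rowK w0.
  have lf : lincomb (m := x :: m) (lift f) = 0 by rewrite lin_lift ?sg ?mem_head.
  have sg' : {subset s <= g} by move=> f' f's; rewrite sg // in_cons f's orbT.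
  have step a : (w - a *: lift f) 0 0 = w 0 0 - a *: (f : A^o).
    by rewrite !mxE unlift_none.
  have lstep a : lincomb (m := x :: m) (w - a *: lift f) = lincomb (m := x :: m) w.
    by rewrite linearB linearZ /= lf scaler0 subr0.
  split=> [[a /(IHs _ sg')]|[w0 [a wa]]].
    by rewrite step lstep => -[-> h0]; split=> //; exists a.
  by exists a; apply/(IHs _ sg'); rewrite step lstep.
exists (map lift g ++ Z0); split.
- move=> z; rewrite mem_cat => /orP[] /mapP[f fZ ->] j; rewrite mxE.
    case: unliftP => [j' _|_]; last exact: glin.
    by rewrite mxE homogN //; case: (hP _ fZ).
  by case: unliftP => [j' _|_]; rewrite ?homog0 ?Zlin.
- suff FZ' (s : seq A^o) : {subset s <= g} -> colons_in F s ->
      colons_in F (map lift s ++ Z0) by exact: FZ'.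
  elim: s => [|f s IHs] /= sg Fs; first exact: colons_in_map.
  have sg' : {subset s <= g} by move=> f' f's; rewrite sg // in_cons f's orbT.
  split; last by apply: IHs sg' _; case: Fs.
  (* [a *: lift f] is a syzygy with first coordinate [a * f], so the colon ideal at [lift f] equals
     the one at [f]. *)
  congr F: Fs.1; apply/seteqP; split=> a /=.
    move=> h0; apply/(rspan_lift _ _ sg'); split; last by rewrite !mxE unlift_none.
    by rewrite linearZ /= lin_lift ?scaler0 // sg ?mem_head.
  by move=> /(rspan_lift _ _ sg')[_]; rewrite !mxE unlift_none.
- move=> w; split=> [w0|/(rspan_lift _ _ (fun _ => id))[]//].
  apply/(rspan_lift _ _ (fun _ => id)); split=> //.
  (* The syzygy [w] expresses [w 0 0 *: x] through [m] with coefficients [- behead_row w]. *)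
  rewrite -gE /=; apply/rspanP; exists (- behead_row w); apply/eqP.
  by rewrite linearN eqr_oppLR -addr_eq0 addrC -lincomb_cons w0.
Qed.

(** A dependent pair, since the new rows are as long as the old list. [xget] picks a list of
    syzygies, with [[::]] as its default value. *)
Definition next_state (st : {r & seq 'rV[A]_r}) : {r & seq 'rV[A]_r} :=
  existT _ (size (projT2 st))
    (xget [::] [set Z | @syzygy_generators _ (projT2 st) Z]%classic).

Section Resolution.
Variable g : seq A^o.
Hypotheses (g_linear : {subset g <= @homog K A 1}) (g_colons : colons_in F g)
  (g_span : [set` @irrelevant K A]%classic = rspan g).

Definition state i : {r & seq 'rV[A]_r} :=
  iter i next_state (existT _ 1%N (map (@row1 A) g)).

Lemma state_syzygies i :
  [/\ {in projT2 (state i), forall x, linear_row x},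
      colons_in F (projT2 (state i))
    & @syzygy_generators _ (projT2 (state i)) (projT2 (state i.+1))].
Proof.
have next (m : {r & seq 'rV[A]_r}) : {in projT2 m, forall x, linear_row x} ->
    colons_in F (projT2 m) ->
    @syzygy_generators _ (projT2 m) (projT2 (next_state m)).
  by move=> lin col; apply: xgetPex (syzygy_generators_exist lin col).
elim: i => [|i [lini coli [linS colS exS]]]; last by split=> //; exact: next.
have lin0 : {in projT2 (state 0), forall x, linear_row x}.
  by move=> _ /mapP[a ag ->] j; rewrite mxE g_linear.
have col0 : colons_in F (projT2 (state 0)).
  by apply: colons_in_map g_colons; exact: row1_inj.
by split=> //; exact: next.
Qed.

(** Well typed because [projT1 (state i.+1)] reduces to the size of [projT2 (state i)]. *)
Definition resolution_diff i :
    'rV[A]_(projT1 (state i.+1)) -> 'rV[A]_(projT1 (state i)) :=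
  lincomb (m := projT2 (state i)).

HB.instance Definition _ i := GRing.Linear.on (@resolution_diff i).

Definition augmentation (v : 'rV[A]_1) : residue A := residue_pi (v 0 0).

Fact augmentation_is_linear : linear augmentation.
Proof.
move=> a v w.
by rewrite /augmentation !mxE /residue_pi rmorphD rmorphM.
Qed.

HB.instance Definition _ :=
  GRing.isLinear.Build A 'rV[A]_1 (residue A) *:%R augmentation
    augmentation_is_linear.

Lemma resolution_diff_homog i k v :
  v \in free_homog (fun _ : 'I_(projT1 (state i.+1)) => i.+1) k ->
  resolution_diff v \in free_homog (fun _ : 'I_(projT1 (state i)) => i) k.
Proof.
have [lin _ _] := state_syzygies i.
rewrite !inE => /forallP hv; apply/forallP => l; rewrite /resolution_diff /lincomb.
have := hv; case: ltnP => [lt_ik|le_ki] {}hv.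
  rewrite (ltnW lt_ik) summxE homog_sum // => j; rewrite mxE.
  rewrite (_ : (k - i = (k - i.+1) + 1)%N); last by rewrite addn1 subnSK.
  by rewrite homogM // lin ?mem_nth.
(* In degrees [k <= i] all entries of [v] are zero, and 0 passes both cases of [free_homog]. *)
rewrite big1 ?mxE => [|j _]; last by rewrite (eqP (hv j)) scale0r.
by rewrite homog0 eqxx if_same.
Qed.

Lemma augmentation_homog k v :
  v \in free_homog (fun _ : 'I_1 => 0%N) k ->
  augmentation v \in @residue_homog K A k.
Proof.
rewrite !inE => /forallP/(_ 0) /=; rewrite subn0 => hv.
by exists (v ord0 0).
Qed.

Lemma augmentation_surj x : exists v, augmentation v = x.
Proof.
by exists (const_mx (repr x)); rewrite /augmentation mxE /residue_pi /= reprK.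
Qed.

Lemma augmentation_exact v :
  augmentation v = 0 <-> exists w, resolution_diff (i := 0) w = v.
Proof.
rewrite -rspanP.
have -> : v = row1 (v 0 0) by apply/rowP => j; rewrite mxE !ord1.
rewrite (rspan_map _ _ (@row1_inj A)) -g_span /augmentation mxE /=.
exact: residue_pi_eq0.
Qed.

Lemma resolution_diff_exact i v :
  resolution_diff v = 0 <-> exists w, resolution_diff (i := i.+1) w = v.
Proof. by have [_ _ [_ _ ->]] := state_syzygies i; rewrite rspanP. Qed.

Lemma linear_resolution_exists :
  exists F : gradedFreeResolution (@residue_homog K A), linear_resolution F.
Proof.
exists (@GradedFreeResolution K A (residue A) (@residue_homog K A)
  (fun i => projT1 (state i)) (fun i _ => i) (fun i => @resolution_diff i) augmentation
  resolution_diff_homog augmentation_homog augmentation_surj augmentation_exact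
  resolution_diff_exact).
by [].
Qed.

End Resolution.

Theorem koszul_filtration :
  standard_graded A -> F [set` @irrelevant K A]%classic -> koszul A.
Proof.
move=> stdA Firr; split=> //; have [g [glin Fg gE]] := generated Firr.
exact: linear_resolution_exists glin Fg gE.
Qed.

End Syzygies.

(** * Lattice points of the dilated polytopes and their last factors *)

Section Exponents.
Variables (R : realType) (n : nat) (b : 'I_n -> nat).
Hypothesis b_gt0 : forall i, (0 < b i)%N.
Local Notation exponent := (exponent R b).

(** Transitivity turns the chain along [enum 'I_n] into inequalities between arbitrary pairs. *)
Lemma lecture_hallP (x : 'rV[R]_n) : lecture_hall b x <->
  [/\ forall i, 0 <= x 0 i / (b i)%:R, forall i, x 0 i / (b i)%:R <= 1
    & forall i j : 'I_n, (i < j)%N -> x 0 i / (b i)%:R <= x 0 j / (b j)%:R].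
Proof.
pose f i := x 0 i / (b i)%:R.
rewrite /lecture_hall /= (path_sortedE le_trans) sorted_pairwise; last exact: le_trans.
rewrite pairwise_rcons pairwise_map all_rcons ler01 /=.
split=> [/and3P[/allP h0 /allP h1 /(pairwiseP _) h]|[h0 h1 h]].
  have mem_f i : f i \in [seq f i | i <- enum 'I_n] by apply/map_f/mem_enum.
  split=> [i|i|i j lt_ij]; [exact: h0 (mem_f i)|exact: h1 (mem_f i)|].
  have := h i i j; rewrite !nth_ord_enum !inE size_enum_ord !ltn_ord.
  exact.
apply/and3P; split; first by apply/allP => _ /mapP[i _ ->]; apply: h0.
  by apply/allP => _ /mapP[i _ ->]; apply: h1.
have : pairwise ltn (map val (enum 'I_n)).
  by rewrite val_enum_ord -(sorted_pairwise ltn_trans) iota_ltn_sorted.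
by rewrite pairwise_map; apply: sub_pairwise => i j; apply: h.
Qed.

(** Clearing the positive denominators leaves integer inequalities, which suit [lia] and [nia]. *)
Lemma is_exponentP (p : 'rV[int]_n) (k : nat) : is_exponent R b (p, k) <->
  [/\ forall i, 0 <= p 0 i, forall i, p 0 i <= (k * b i)%:Z
    & forall i j : 'I_n, (i < j)%N -> p 0 i * (b j)%:Z <= p 0 j * (b i)%:Z].
Proof.
have bR i : 0 < (b i)%:R :> R by rewrite ltr0n.
rewrite /is_exponent; split.
  move=> /set_mem [x /lecture_hallP[h0 h1 h] /= xE].
  have pE i : (p 0 i)%:~R = k%:R * x 0 i by have /rowP/(_ i) := xE; rewrite !mxE.
  have x0 i : 0 <= x 0 i by have := h0 i; rewrite pmulr_lge0 ?invr_gt0.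
  split=> [i|i|i j lt_ij].
  - by rewrite -(ler0z R) pE mulr_ge0 ?ler0n.
  - rewrite -(ler_int R) pE -pmulrn natrM ler_wpM2l ?ler0n //.
    by have := h1 i; rewrite ler_pdivrMr // mul1r.
  - rewrite -(ler_int R) !rmorphM /= !pE -!mulrA ler_wpM2l ?ler0n //.
    by have := h _ _ lt_ij; rewrite ler_pdivrMr // mulrAC ler_pdivlMr.
case=> h0 h1 h; apply/mem_set => /=.
(* In degree 0 one cannot divide by [k], but the bounds force [p = 0]. *)
have [k0|k0] := eqVneq k 0%N.
  exists 0; first exact: lecture_hall0.
  rewrite scaler0; apply/rowP => i; rewrite !mxE.
  suff -> : p 0 i = 0 by [].
  by apply/le_anti; rewrite h0 andbT; have := h1 i; rewrite k0.
have kR : 0 < k%:R :> R by rewrite ltr0n lt0n.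
exists (k%:R^-1 *: map_mx (fun z : int => z%:~R) p); last first.
  by rewrite scalerA divff ?scale1r // gt_eqF.
apply/lecture_hallP; split=> [i|i|i j lt_ij]; rewrite !mxE.
- by rewrite divr_ge0 ?mulr_ge0 ?invr_ge0 ?ler0n ?ler0z.
- rewrite ler_pdivrMr // mul1r mulrC ler_pdivrMr // -natrM mulnC.
  by have := h1 i; rewrite -(ler_int R).
- rewrite ler_pdivrMr // mulrAC ler_pdivlMr // -!mulrA ler_wpM2l ?invr_ge0 ?ler0n //.
  by have := h _ _ lt_ij; rewrite -(ler_int R) !rmorphM.
Qed.

Lemma exponentP (u : exponent) :
  [/\ forall i, 0 <= u.1 0 i, forall i, u.1 0 i <= (u.2 * b i)%:Z
    & forall i j : 'I_n, (i < j)%N -> u.1 0 i * (b j)%:Z <= u.1 0 j * (b i)%:Z].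
Proof. by apply/is_exponentP; rewrite -surjective_pairing; case: u. Qed.

Lemma exponent_eq (u v : exponent) :
  u.2 = v.2 -> (forall i, u.1 0 i = v.1 0 i) -> u = v.
Proof.
move=> uv2 uv1; apply: val_inj => /=.
rewrite [LHS]surjective_pairing [RHS]surjective_pairing.
by congr pair; first exact/rowP.
Qed.

Lemma exponent_mulE (u v : exponent) i :
  (exponent_mul u v).1 0 i = u.1 0 i + v.1 0 i.
Proof. by rewrite mxE. Qed.

Lemma exponent_mulI (u v w : exponent) :
  exponent_mul u w = exponent_mul v w -> u = v.
Proof.
move=> uv; apply: exponent_eq => [|i].
  by have /(congr1 (fun z : exponent => z.2))/= /addIn := uv.
by have /(congr1 (fun z : exponent => z.1 0 i)) := uv; rewrite !exponent_mulE => /addIr.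
Qed.

Definition last_part (u : exponent) : 'rV[int]_n :=
  \row_i Num.max 0 (u.1 0 i - (u.2.-1 * b i)%:Z).

Definition init_part (u : exponent) : 'rV[int]_n :=
  \row_i Num.min (u.1 0 i) (u.2.-1 * b i)%:Z.

(** For k > 0, division by b_i gives max(0, p_i/b_i - (k-1)), a monotone function of p_i/b_i with
    values at most 1. In degree 0 the point is the origin. *)
Fact last_part_subproof (u : exponent) : is_exponent R b (last_part u, 1%N).
Proof.
have [h0 h1 h] := exponentP u.
apply/is_exponentP; split=> [i|i|i j lt_ij]; rewrite !mxE.
- by rewrite le_max lexx.
- have := h1 i; case: (u.2) => [|k] /=; nia.
- have := h _ _ lt_ij; have := b_gt0 i; have := b_gt0 j.
  set k := u.2.-1; move: (u.1 0 i) (u.1 0 j) (b i) (b j) => x y c d; nia.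
Qed.

(** For k > 0 the ratios become min(p_i/b_i, k-1), and truncation preserves their order. *)
Fact init_part_subproof (u : exponent) : is_exponent R b (init_part u, u.2.-1).
Proof.
have [h0 h1 h] := exponentP u.
apply/is_exponentP; split=> [i|i|i j lt_ij]; rewrite !mxE.
- by rewrite le_min h0.
- by rewrite ge_min lexx orbT.
- have := h _ _ lt_ij; have := b_gt0 i; have := b_gt0 j.
  set k := u.2.-1; move: (u.1 0 i) (u.1 0 j) (b i) (b j) => x y c d; nia.
Qed.

Definition last_factor (u : exponent) : exponent := Exponent (last_part_subproof u).
Definition init_factor (u : exponent) : exponent := Exponent (init_part_subproof u).

Lemma last_factorE (u : exponent) i :
  (last_factor u).1 0 i = Num.max 0 (u.1 0 i - (u.2.-1 * b i)%:Z).
Proof. by rewrite mxE. Qed.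

Lemma init_last (u : exponent) : (0 < u.2)%N ->
  exponent_mul (init_factor u) (last_factor u) = u.
Proof.
move=> u0; apply: exponent_eq => [|i]; first by rewrite /= addn1 prednK.
by rewrite !mxE; lia.
Qed.

(** In degree 1 the coordinates lie between 0 and [b i], so they come from functions into ['I_B];
    [pmap insub] discards the tuples outside the polytope. *)
Lemma exponent_deg1_enum :
  exists s : seq exponent, forall q : exponent, q.2 = 1%N -> q \in s.
Proof.
pose B := (\max_i b i).+1.
pose s := [seq (\row_i (f i)%:Z, 1%N) | f : {ffun 'I_n -> 'I_B}] : seq ('rV[int]_n * nat).
exists (pmap insub s) => q q1; rewrite mem_pmap_sub /=.
have [h0 h1 _] := exponentP q.
apply/mapP; exists [ffun i : 'I_n => inord `|(q.1 0 i)%R|%N]; first by rewrite mem_enum.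
rewrite [LHS]surjective_pairing q1; congr pair; apply/rowP => i.
rewrite !mxE ffunE inordK; first by rewrite gez0_abs.
rewrite ltnS (leq_trans _ (leq_bigmax i)) // -lez_nat gez0_abs //.
by have := h1 i; rewrite q1 mul1n.
Qed.

End Exponents.

(** * The Koszul filtration of the Ehrhart ring *)

Section EhrhartKoszul.
Variables (K : fieldType) (R : realType) (n : nat) (b : 'I_n -> nat).
Hypothesis b_gt0 : forall i, (0 < b i)%N.
Local Notation exponent := (exponent R b).
Local Notation A := (ehrhart_ring K R b).
Implicit Types (u v w q r : exponent) (x y : A) (s : seq exponent).

Definition monomial u : A := << u >>.

Lemma monomialM u v : monomial u * monomial v = monomial (exponent_mul u v).
Proof. by rewrite /monomial [LHS]malgM_def fgmulUU mulr1. Qed.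

Lemma monomial_homog u : monomial u \in @homog K A u.2.
Proof.
apply/ehrhart_homogP => v; rewrite mcoeffU1.
by case: (u =P v) => [->|_]; rewrite ?eqxx.
Qed.

Lemma sum_monomials x : x = \sum_(u <- msupp x) x@_u *: monomial u.
Proof. by rewrite {1}[x]monalgE; apply: eq_bigr => u _; exact: monalgU_scale. Qed.

(** Exponents cancel, so distinct terms of [x] stay distinct after multiplication by a monomial. *)
Lemma mcoeff_mul_monomial x q u : (x * monomial q)@_(exponent_mul u q) = x@_u.
Proof.
rewrite {1}[x]sum_monomials mulr_suml raddf_sum /=.
have [ux|ux] := boolP (u \in msupp x).
  rewrite (big_rem u) //= big1_seq ?addr0 => [|v /andP[_ vx]].
    by rewrite -scalerAl monomialM mcoeffZ mcoeffU1 eqxx mulr1.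
  rewrite -scalerAl monomialM mcoeffZ mcoeffU1.
  case: eqP => [/exponent_mulI vu|]; last by rewrite mulr0.
  by move: vx; rewrite vu mem_rem_uniqF ?fset_uniq.
rewrite (mcoeff_outdom ux) big1_seq // => v /andP[_ vx].
rewrite -scalerAl monomialM mcoeffZ mcoeffU1.
case: eqP => [/exponent_mulI vu|]; last by rewrite mulr0.
by rewrite -vu vx in ux.
Qed.

Lemma msupp_mul_monomial x q w : (x * monomial q)@_w != 0 ->
  exists2 u, x@_u != 0 & w = exponent_mul u q.
Proof.
rewrite mcoeff_neq0 => /msuppM_le[u [v [ux]]].
by rewrite msuppU1 in_fset1 => /eqP -> ->; exists u => //; rewrite mcoeff_neq0.
Qed.

Lemma rspan_monomials s x : @rspan A A^o (map monomial s) x <->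
  forall u, x@_u != 0 -> exists2 q, q \in s & exists v, u = exponent_mul v q.
Proof.
split.
  elim: s x => [|q s IHs] x /=; first by move=> -> u; rewrite mcoeff0 eqxx.
  case=> a /IHs h u xu.
  have [au|au] := eqVneq (a * monomial q)@_u 0.
    have [|r rs [v uE]] := h u; first by rewrite mcoeffB au subr0.
    by exists r; [rewrite in_cons rs orbT|exists v].
  have [v _ ->] := msupp_mul_monomial au.
  by exists q; [exact: mem_head|exists v].
move=> h; rewrite [x]sum_monomials big_seq.
elim/big_rec: _ => [|u y ux hy]; first by apply/rspanP; exists 0; rewrite linear0.
apply: rspanD hy; rewrite -mcoeff_neq0 in ux; have [q qs [v ->]] := h u ux.
rewrite -monomialM scalerAl; apply: (@rspanZ A A^o); apply: rspan_mem.
exact: map_f.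
Qed.

Definition support_ideal (P : pred exponent) : set A :=
  [set x : A | forall u, x@_u != 0 -> P u]%classic.

(** By the first condition the degree 1 points suffice as generators, [u] being a multiple of its
    last factor. The second then makes [support_ideal P] an ideal: for [q] of degree 1, the last
    factor of a multiple of [q] is coordinatewise at most [q]. *)
Definition last_factor_stable (P : pred exponent) :=
  (forall u, P u = (0 < u.2)%N && P (last_factor b_gt0 u)) /\
  forall q r, q.2 = 1%N -> r.2 = 1%N -> (forall i, q.1 0 i <= r.1 0 i) ->
    P r -> P q.

Definition filtration : set (set A) :=
  [set I | exists2 P, last_factor_stable P & I = support_ideal P]%classic.

Lemma positive_degree_stable : last_factor_stable (fun u => 0 < u.2)%N.
Proof. by split=> [u|q r ->]; rewrite ?andbT. Qed.

Lemma irrelevantE :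
  [set` @irrelevant K A]%classic = support_ideal (fun u => 0 < u.2)%N.
Proof.
apply/seteqP; split=> x /=.
  move=> /irrelevant_pad[N [c [hc c0 /(_ N (leqnn N)) ->]]] u.
  apply: contraNT; rewrite -eqn0Ngt => /eqP u0.
  rewrite raddf_sum big1 // => -[[|k] /= _] _; first by rewrite c0 mcoeff0.
  apply/eqP; apply: contra_eqT u0 => /((ehrhart_homogP _ _).1 (hc k.+1)) ->.
  by [].
move=> h; rewrite [x]sum_monomials big_seq.
elim/big_rec: _ => [|u y ux hy]; first exact: irrelevant0.
apply: irrelevantD hy; rewrite -mcoeff_neq0 in ux.
apply: irrelevant_homog (h u ux).
by rewrite -[_ *: _]addr0 homog_linear ?homog0 ?monomial_homog.
Qed.

Definition weight q : int := \sum_i q.1 0 i.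

(** The differences r_i - q_i are nonnegative with sum at most 0. So ordering by weight refines the
    coordinatewise order. *)
Lemma weight_le_eq q r : q.2 = r.2 -> (forall i, q.1 0 i <= r.1 0 i) ->
  weight r <= weight q -> q = r.
Proof.
move=> qr2 le_qr le_w; apply: exponent_eq => // i; apply/eqP.
have := le_w; rewrite -subr_le0 /weight -sumrB => le0.
have /eqP : \sum_i (r.1 0 i - q.1 0 i) = 0.
  by apply/le_anti; rewrite le0 sumr_ge0 // => j _; rewrite subr_ge0.
rewrite psumr_eq0 => [/allP/(_ i (mem_index_enum i))|j _]; last by rewrite subr_ge0.
by rewrite subr_eq0 eq_sym.
Qed.

Definition unsaturated q u :=
  [exists i, (0 < q.1 0 i) && (u.1 0 i < (u.2 * b i)%:Z)].

(** For k > 0, p_i < k b_i means p_i - (k-1) b_i < b_i, and truncation at 0 does not affect this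
    since b_i > 0. In degree 0 it would mean p_i < 0. *)
Lemma unsaturated_stable q : last_factor_stable (unsaturated q).
Proof.
split=> [u|r r' r1 r'1 le_r /existsP[i /andP[qi ri]]]; last first.
  by apply/existsP; exists i; rewrite r'1 in ri; rewrite qi r1 (le_lt_trans (le_r i) ri).
have [h0 _ _] := exponentP b_gt0 u; rewrite /unsaturated.
case: posnP => [u0|u0] /=.
  by apply/existsP => -[i /andP[_]]; rewrite u0 mul0n ltNge h0.
apply: eq_existsb => i; congr andb; rewrite (last_factorE b_gt0) /= mul1n.
have := b_gt0 i; rewrite -{1}(prednK u0) mulSn; move: (u.2.-1 * b i)%N => m; lia.
Qed.

(** Weights decrease because [colons_in] compares a generator with those behind it. The head is then
    below no later point, so the tail stays downward closed and the induction applies. *)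
Lemma colons_in_filtration s : uniq s ->
  sorted (fun q r => weight r <= weight q) s ->
  {in s, forall q, q.2 = 1%N} ->
  {in s, forall r q, q.2 = 1%N -> (forall i, q.1 0 i <= r.1 0 i) -> q \in s} ->
  colons_in filtration (map monomial s : seq A^o).
Proof.
elim: s => //= q s IHs /andP[qs us] sorted_s deg1 closed.
have weight_s r : r \in s -> weight r <= weight q.
  move: sorted_s; rewrite path_sortedE; last by move=> ? ? ? h1 h2; exact: le_trans h2 h1.
  by case/andP=> /allP h _ /h.
have q1 : q.2 = 1%N by apply: deg1; exact: mem_head.
have deg1s : {in s, forall r, r.2 = 1%N} by move=> r rs; rewrite deg1 // in_cons rs orbT.
have not_le r : r \in s -> ~ forall i, q.1 0 i <= r.1 0 i.
  move=> rs le_qr; have qr : q = r.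
    by apply: weight_le_eq (weight_s _ rs); rewrite // q1 deg1s.
  by rewrite qr rs in qs.
split; last first.
  apply: IHs => //; first exact: path_sorted sorted_s.
  move=> r rs q' q'1 le_q'r.
  have : q' \in q :: s by apply: closed le_q'r => //; rewrite in_cons rs orbT.
  rewrite in_cons => /predU1P[q'E|//].
  by case: (not_le r rs); rewrite -q'E.
exists (unsaturated q); first exact: unsaturated_stable.
have key u : (exists2 r, r \in s & exists v, exponent_mul u q = exponent_mul v r)
    <-> unsaturated q u.
  have [h0 _ _] := exponentP b_gt0 q; have [_ u1 _] := exponentP b_gt0 u; split.
    (* Let k be the common degree of [u] and [v]. If u_i = k b_i wherever q_i > 0, then v_i <= k b_i
       gives q_i <= r_i there, and elsewhere q_i = 0 <= r_i. This contradicts [not_le]. *)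
    case=> r rs [v uqE]; apply/negbNE/negP => /existsPn sat; apply: (not_le r rs) => i.
    have uv2 : u.2 = v.2.
      have /(congr1 (fun w : exponent => w.2)) /= := uqE.
      by rewrite q1 (deg1s r rs) => /addIn.
    have [r0 _ _] := exponentP b_gt0 r; have [_ v1 _] := exponentP b_gt0 v.
    have /(congr1 (fun w : exponent => w.1 0 i)) := uqE; rewrite !exponent_mulE.
    have := sat i; have := r0 i; have := v1 i; have := h0 i; rewrite uv2; lia.
  case/existsP=> i /andP[qi ui].
  have uq0 : (0 < (exponent_mul u q).2)%N by rewrite /= q1 addn1.
  (* This point is coordinatewise at most [q], hence in the list, and strictly smaller at the
     unsaturated coordinate [i], hence in the tail. *)
  exists (last_factor b_gt0 (exponent_mul u q)); last first.
    by exists (init_factor b_gt0 (exponent_mul u q)); rewrite init_last.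
  have lastE j : (last_factor b_gt0 (exponent_mul u q)).1 0 j =
      Num.max 0 (u.1 0 j + q.1 0 j - (u.2 * b j)%:Z).
    by rewrite last_factorE exponent_mulE /= q1 addn1.
  have : last_factor b_gt0 (exponent_mul u q) \in q :: s.
    apply: (closed q); rewrite ?mem_head // => j; rewrite lastE.
    by have := u1 j; have := h0 j; lia.
  rewrite in_cons => /predU1P[lastq|//].
  by have := lastE i; rewrite lastq; lia.
apply/seteqP; split=> a /=.
  move=> /rspan_monomials h u au; apply/key; apply: h.
  by rewrite mcoeff_mul_monomial.
move=> h; apply/rspan_monomials => w /msupp_mul_monomial[u au ->].
exact/key/h.
Qed.

Lemma filtration_generated I : filtration I -> exists g : seq A^o,
  [/\ {subset g <= @homog K A 1}, colons_in filtration g & I = rspan g].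
Proof.
case=> P [PE Pdown] ->; have [e he] := exponent_deg1_enum R b_gt0.
pose ge_weight q r := weight r <= weight q.
pose s := sort ge_weight (undup [seq q : exponent <- e | (q.2 == 1%N) && P q]).
have mem_s q : (q \in s) = (q.2 == 1%N) && P q.
  rewrite mem_sort mem_undup mem_filter andb_idr // => /andP[/eqP q1 _].
  exact: he.
have deg1 : {in s, forall q, q.2 = 1%N} by move=> q; rewrite mem_s => /andP[/eqP].
exists (map monomial s); split.
- by move=> _ /mapP[q qs ->]; rewrite -(deg1 q qs) monomial_homog.
- apply: colons_in_filtration => //.
  + by rewrite sort_uniq undup_uniq.
  + by apply: sort_sorted => q r; exact: le_total.
  + move=> r; rewrite mem_s => /andP[/eqP r1 Pr] q q1 le_qr.
    by rewrite mem_s q1 eqxx (Pdown _ _ q1 r1 le_qr Pr).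
apply/seteqP; split=> x.
  move=> h; apply/rspan_monomials => u /h; rewrite PE => /andP[u0 Plast].
  exists (last_factor b_gt0 u); first by rewrite mem_s Plast.
  by exists (init_factor b_gt0 u); rewrite init_last.
move=> /rspan_monomials h u /h[q]; rewrite mem_s => /andP[/eqP q1 Pq] [v ->].
rewrite PE /= q1 addn1 /=; apply: Pdown Pq => // i.
have [q0 _ _] := exponentP b_gt0 q; have [_ v1 _] := exponentP b_gt0 v.
rewrite last_factorE exponent_mulE /= q1 addn1 /=.
by have := q0 i; have := v1 i; lia.
Qed.

Lemma ehrhart_standard_graded : standard_graded A.
Proof.
split.
- move=> x /ehrhart_homogP hx; exists x@_(exponent_one R b).
  apply/malgP => u; rewrite mcoeffZ mcoeff1.
  have [->|u1] := eqVneq u (mone : exponent); first by rewrite mulr1.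
  rewrite mulr0; apply: contra_neq_eq u1 => /hx; exact: exponent_deg0.
- have [e he] := exponent_deg1_enum R b_gt0.
  exists (map monomial e) => x /ehrhart_homogP hx.
  exists [seq (x@_u, monomial u) | u <- msupp x]; split.
    move=> _ /mapP[u ux ->] /=; apply: map_f; apply: he; apply: hx.
    by rewrite mcoeff_neq0.
  by rewrite big_map [LHS]sum_monomials.
move=> S [S1 SD SM] hS x.
(* Splitting off last factors writes every monomial as a product of monomials of degree 1. *)
have S_monomial k u : u.2 = k -> monomial u \in S.
  elim: k u => [|k IHk] u uk; first by rewrite (exponent_deg0 uk).
  have u0 : (0 < u.2)%N by rewrite uk.
  have last1 := monomial_homog (last_factor b_gt0 u).
  have lastS := hS _ last1.
  have initS : monomial (init_factor b_gt0 u) \in S by apply: IHk; rewrite /= uk.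
  rewrite -(init_last b_gt0 u0) -monomialM.
  exact: (SM _ _ initS lastS).
rewrite [x]sum_monomials; elim/big_rec: _ => [|u y _ yS].
  (* [subalg_closed] provides 1 and linear combinations, so 0 is obtained as -1 + 1. *)
  by have := SD (-1) 1 1 S1 S1; rewrite scaleN1r addNr.
exact: (SD _ _ _ (S_monomial _ _ erefl) yS).
Qed.

Lemma ehrhart_koszul : koszul A.
Proof.
apply: (koszul_filtration filtration_generated); first exact: ehrhart_standard_graded.
by exists (fun u => 0 < u.2)%N; [exact: positive_degree_stable|exact: irrelevantE].
Qed.

End EhrhartKoszul.

Local Close Scope ring_scope.

Theorem theorem6p7 (R : realType) (n : nat) (b : 'I_n -> nat)
    (hn : 0 < n) (hb : forall i : 'I_n, 0 < b i) :
  koszul (ehrhart_ring R[i] R b).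
Proof. exact: ehrhart_koszul. Qed.
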